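(* Let $(A,\mathcal S,[\cdot,\cdot]_{\mathcal S},\beta)$ be a Leibniz pair and $\mathfrak h$ a $\mathbb K$-Lie algebra. Any crossed homomorphism $H:\mathcal S\to\mathfrak h\otimes_{\mathbb K}A$ (with respect to the action $x\cdot(g\otimes a)=g\otimes\beta(x)(a)$ of $\mathcal S$ on $\mathfrak h\otimes_{\mathbb K}A$) induces a left module category structure on the category $\mathsf{ARep}_{\mathbb K}(\mathcal S)$ of admissible representations of $\mathcal S$ over the monoidal category $\mathsf{Rep}_{\mathbb K}(\mathfrak h)$ of representations of $\mathfrak h$, with bifunctor $$\mathcal F_H:\mathsf{Rep}_{\mathbb K}(\mathfrak h)\times\mathsf{ARep}_{\mathbb K}(\mathcal S)\to\mathsf{ARep}_{\mathbb K}(\mathcal S),\qquad \mathcal F_H((V;\theta),(M;\rho))=(V\otimes_{\mathbb K}M;(\rho\boxplus\theta)\circ\iota_H)$$ on objects and $\mathcal F_H(\psi,\phi)=\psi\otimes\phi$ on morphisms.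
   Context: All vector spaces are over an algebraically closed field $\mathbb K$ of characteristic $0$; $A$ is a commutative associative $\mathbb K$-algebra and $\mathrm{Der}_{\mathbb K}(A)$ is its Lie algebra of $\mathbb K$-linear derivations. A Leibniz pair $(A,\mathcal S,[\cdot,\cdot]_{\mathcal S},\beta)$ is a $\mathbb K$-Lie algebra $\mathcal S$ with a $\mathbb K$-Lie algebra homomorphism $\beta:\mathcal S\to\mathrm{Der}_{\mathbb K}(A)$. An admissible representation $(M;\rho)$ of $\mathcal S$ is an $A$-module $M$ with a $\mathbb K$-Lie algebra homomorphism $\rho:\mathcal S\to\mathfrak{gl}_{\mathbb K}(M)$ such that $\rho(x)(am)=a\rho(x)m+\beta(x)(a)m$ for $x\in\mathcal S,a\in A,m\in M$. A homomorphism $(M;\rho)\to(M';\rho')$ of admissible representations is an $A$-module homomorphism $\phi$ with $\phi\circ\rho(x)=\rho'(x)\circ\phi$ for all $x\in\mathcal S$. These form $\mathsf{ARep}_{\mathbb K}(\mathcal S)$. $\mathfrak h\otimes_{\mathbb K}A$ is a Lie algebra with $[g\otimes a,h\otimes b]=[g,h]_{\mathfrak h}\otimes ab$. A crossed homomorphism $H:\mathcal S\to\mathfrak h\otimes_{\mathbb K}A$ is a $\mathbb K$-linear map with $H[x,y]_{\mathcal S}=x\cdot(Hy)-y\cdot(Hx)+[Hx,Hy]$ for all $x,y\in\mathcal S$. The Leibniz pair $\mathcal S\ltimes_\beta(\mathfrak h\otimes_{\mathbb K}A)$ has underlying Lie algebra $\mathcal S\oplus(\mathfrak h\otimes_{\mathbb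 K}A)$ with $[(x,g\otimes a),(y,h\otimes b)]=([x,y]_{\mathcal S},h\otimes\beta(x)(b)-g\otimes\beta(y)(a)+[g,h]_{\mathfrak h}\otimes ab)$ and structure map $\tilde\beta(x,g\otimes a)=\beta(x)$; $\iota_H:\mathcal S\to\mathcal S\ltimes_\beta(\mathfrak h\otimes_{\mathbb K}A)$ is $\iota_H(x)=(x,Hx)$. For $(V;\theta)\in\mathsf{Rep}_{\mathbb K}(\mathfrak h)$ and $(M;\rho)\in\mathsf{ARep}_{\mathbb K}(\mathcal S)$, $V\otimes_{\mathbb K}M$ has the $A$-module structure $a(v\otimes m)=v\otimes am$ and $(\rho\boxplus\theta)(x,g\otimes a)(v\otimes m)=v\otimes\rho(x)m+\theta(g)v\otimes am$. $\mathsf{Rep}_{\mathbb K}(\mathfrak h)$ is monoidal under the usual tensor product of representations, with unit the trivial representation $(\mathbb K;0)$ and the usual associativity and unit isomorphisms. A left module category over a monoidal category $(\mathcal C,\otimes,a,\mathbf 1,l,r)$ is a category $\mathcal M$ with a bifunctor $\otimes^{\mathcal M}:\mathcal C\times\mathcal M\to\mathcal M$ and natural isomorphisms $a^{\mathcal M}_{X,Y,M}:(X\otimes Y)\otimes^{\mathcal M}M\to X\otimes^{\mathcal M}(Y\otimes^{\mathcal M}M)$, $l^{\mathcal M}_M:\mathbf 1\otimes^{\mathcal M}M\to M$ such that $a^{\mathcal M}_{X,Y,Z\otimes^{\mathcal M}M}\circ a^{\mathcal M}_{X\otimes Y,Z,M}=(\mathrm{Id}_X\otimes^{\mathcal M}a^{\mathcal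 M}_{Y,Z,M})\circ a^{\mathcal M}_{X,Y\otimes Z,M}\circ(a_{X,Y,Z}\otimes^{\mathcal M}\mathrm{Id}_M)$ and $(\mathrm{Id}_X\otimes^{\mathcal M}l^{\mathcal M}_M)\circ a^{\mathcal M}_{X,\mathbf 1,M}=r_X\otimes^{\mathcal M}\mathrm{Id}_M$ for all $X,Y,Z\in\mathcal C$, $M\in\mathcal M$. *)

(* Defs.v *)
From HB Require Import structures.
From mathcomp Require Import all_boot all_algebra.
From mathcomp Require Import boolp.

Set Implicit Arguments.
Unset Strict Implicit.
Unset Printing Implicit Defensive.

Import GRing.Theory.
Local Open Scope ring_scope.
Local Open Scope quotient_scope.

(* Commutative associative unital algebras. The structure comAlgType of ssralg is
   not used because it excludes the zero algebra. *)
HB.mixin Record Lmodule_isUComAlgebra (K : fieldType) A of GRing.Lmodule K A := {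
  amul : A -> A -> A;
  aone : A;
  amul_linear : forall a, linear (amul a);
  amulA : associative amul;
  amulC : commutative amul;
  amul1a : left_id aone amul
}.

#[short(type="ucomAlgType")]
HB.structure Definition UComAlgebra (K : fieldType) :=
  {A of GRing.Lmodule K A & Lmodule_isUComAlgebra K A}.

HB.mixin Record Lmodule_isLieAlgebra (K : fieldType) L of GRing.Lmodule K L := {
  lie : L -> L -> L;
  lie_linearl : forall z, linear (lie^~ z);
  lie_linearr : forall x, linear (lie x);
  liexx : forall x, lie x x = 0;
  lie_jacobi : forall x y z, lie x (lie y z) + lie y (lie z x) + lie z (lie x y) = 0
}.

#[short(type="lieAlgType")]
HB.structure Definition LieAlgebra (K : fieldType) :=
  {L of GRing.Lmodule K L & Lmodule_isLieAlgebra K L}.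

Section Linear.
Variables (K : fieldType) (U V W : lmodType K).

Definition is_bilinear (f : U -> V -> W) : Prop :=
  (forall v, linear (f^~ v)) /\ (forall u, linear (f u)).

Lemma linD (f : U -> V) : linear f -> {morph f : x y / x + y}.
Proof. by move=> fl x y; have := fl 1 x y; rewrite !scale1r. Qed.

Lemma lin0 (f : U -> V) : linear f -> f 0 = 0.
Proof. by move=> fl; apply: (addrI (f 0)); rewrite -linD // !addr0. Qed.

Lemma linZ (f : U -> V) : linear f -> forall k x, f (k *: x) = k *: f x.
Proof. by move=> fl k x; have := fl k x 0; rewrite !addr0 lin0 // addr0. Qed.

Lemma linN (f : U -> V) : linear f -> {morph f : x / - x}.
Proof. by move=> fl x; rewrite -scaleN1r linZ // scaleN1r. Qed.

Lemma linB (f : U -> V) : linear f -> {morph f : x y / x - y}.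
Proof. by move=> fl x y; rewrite linD // linN. Qed.

Lemma lin_comp (f : V -> W) (g : U -> V) : linear f -> linear g -> linear (f \o g).
Proof. by move=> fl gl k x y /=; rewrite gl fl. Qed.

Lemma lin_add (f g : U -> V) : linear f -> linear g -> linear (fun x => f x + g x).
Proof. by move=> fl gl k x y; rewrite fl gl scalerDr addrACA. Qed.

Lemma linear_eq (f g : {linear U -> V}) : f =1 g -> f = g.
Proof.
case: f g => [f [[f1] [f2]]] [g [[g1] [g2]]] /= /funext fg.
rewrite /= in fg; subst g; do 2 f_equal.
- by congr GRing.isNmodMorphism.phant_Build; exact: Prop_irrelevance.
- by congr GRing.isScalable.phant_Build; exact: Prop_irrelevance.
Qed.
End Linear.

Section TensorDef.
Variables (K : fieldType) (V W : lmodType K).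

(* A list [:: (v1, w1); ...; (vn, wn)] stands for the formal sum of the vi ⊗ wi. *)
Inductive tensor_eqv : seq (V * W) -> seq (V * W) -> Prop :=
| TEqvRefl s : tensor_eqv s s
| TEqvSym s t : tensor_eqv s t -> tensor_eqv t s
| TEqvTrans s t u : tensor_eqv s t -> tensor_eqv t u -> tensor_eqv s u
| TEqvCat s s' t t' : tensor_eqv s s' -> tensor_eqv t t' ->
    tensor_eqv (s ++ t) (s' ++ t')
| TEqvComm s t : tensor_eqv (s ++ t) (t ++ s)
| TEqvZero w : tensor_eqv [:: (0, w)] [::]
| TEqvAddl v v' w : tensor_eqv [:: (v + v', w)] [:: (v, w); (v', w)]
| TEqvAddr v w w' : tensor_eqv [:: (v, w + w')] [:: (v, w); (v, w')]
| TEqvScale k v w : tensor_eqv [:: (k *: v, w)] [:: (v, k *: w)].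

Definition tensor_rel : rel (seq (V * W)) := fun s t => `[< tensor_eqv s t >].

Lemma tensor_rel_refl : reflexive tensor_rel.
Proof. by move=> s; apply/asboolP; exact: TEqvRefl. Qed.

Lemma tensor_rel_sym : symmetric tensor_rel.
Proof. by move=> s t; apply/asboolP/asboolP; exact: TEqvSym. Qed.

Lemma tensor_rel_trans : transitive tensor_rel.
Proof.
by move=> t s u /asboolP st /asboolP tu; apply/asboolP; exact: TEqvTrans st tu.
Qed.

Canonical tensor_equiv := EquivRel tensor_rel tensor_rel_refl tensor_rel_sym
  tensor_rel_trans.

Definition tensor := {eq_quot tensor_rel}.
HB.instance Definition _ := Choice.on tensor.
HB.instance Definition _ : EqQuotient _ tensor_rel tensor := EqQuotient.on tensor.

Lemma tensor_eqP s t : tensor_eqv s t -> \pi_tensor s = \pi_tensor t.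
Proof. by move=> st; apply/eqquotP/asboolP. Qed.

Lemma tensor_reprP s : tensor_eqv (repr (\pi_tensor s)) s.
Proof. by apply/asboolP/(@eqquotP _ _ tensor); rewrite reprK. Qed.

Definition tensor_scale_seq (k : K) (s : seq (V * W)) :=
  [seq (k *: p.1, p.2) | p <- s].

Definition pure (v : V) (w : W) : tensor := \pi_tensor [:: (v, w)].
Definition tensor_zero : tensor := \pi_tensor [::].
Definition tensor_add (x y : tensor) : tensor := \pi_tensor (repr x ++ repr y).
Definition tensor_scale (k : K) (x : tensor) : tensor :=
  \pi_tensor (tensor_scale_seq k (repr x)).
Definition tensor_opp : tensor -> tensor := tensor_scale (-1).

Lemma tensor_scale_eqv k s t : tensor_eqv s t ->
  tensor_eqv (tensor_scale_seq k s) (tensor_scale_seq k t).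
Proof.
elim=> {s t}.
- by move=> s; exact: TEqvRefl.
- by move=> s t _; exact: TEqvSym.
- by move=> s t u _ + _; exact: TEqvTrans.
- by move=> s s' t t' _ ? _ ?; rewrite /tensor_scale_seq !map_cat; exact: TEqvCat.
- by move=> s t; rewrite /tensor_scale_seq !map_cat; exact: TEqvComm.
- by move=> w; rewrite /= scaler0; exact: TEqvZero.
- by move=> v v' w; rewrite /= scalerDr; exact: TEqvAddl.
- by move=> v w w'; exact: TEqvAddr.
- move=> l v w /=; rewrite scalerA mulrC -scalerA; exact: TEqvScale.
Qed.

Lemma tensor_add_pi s t :
  tensor_add (\pi_tensor s) (\pi_tensor t) = \pi_tensor (s ++ t).
Proof. by apply: tensor_eqP; apply: TEqvCat; exact: tensor_reprP. Qed.

Lemma tensor_scale_pi k s :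
  tensor_scale k (\pi_tensor s) = \pi_tensor (tensor_scale_seq k s).
Proof. by apply: tensor_eqP; apply: tensor_scale_eqv; exact: tensor_reprP. Qed.

Lemma tensor_piP (x : tensor) : exists s, x = \pi_tensor s.
Proof. by exists (repr x); rewrite reprK. Qed.

Lemma tensor_addA : associative tensor_add.
Proof.
move=> x y z; case: (tensor_piP x) (tensor_piP y) (tensor_piP z) => s -> [t ->] [u ->].
by rewrite !tensor_add_pi catA.
Qed.

Lemma tensor_addC : commutative tensor_add.
Proof.
move=> x y; case: (tensor_piP x) (tensor_piP y) => s -> [t ->].
by rewrite !tensor_add_pi; apply: tensor_eqP; exact: TEqvComm.
Qed.

Lemma tensor_add0 : left_id tensor_zero tensor_add.
Proof. by move=> x; case: (tensor_piP x) => s ->; rewrite tensor_add_pi. Qed.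

Lemma tensor_addN : left_inverse tensor_zero tensor_opp tensor_add.
Proof.
move=> x; case: (tensor_piP x) => s ->; rewrite /tensor_opp tensor_scale_pi.
elim: s => [|[v w] s IHs]; first by rewrite tensor_add_pi.
rewrite -[(v, w) :: s]cat1s /tensor_scale_seq map_cat -!tensor_add_pi.
rewrite -tensor_addA [tensor_add _ (tensor_add _ (\pi_tensor s))]tensor_addC.
rewrite -tensor_addA [tensor_add _ (\pi_tensor (map _ s))]tensor_addC IHs.
rewrite [tensor_add _ tensor_zero]tensor_addC tensor_add0 tensor_add_pi /=.
apply: tensor_eqP; rewrite scaleN1r; apply: TEqvTrans (TEqvSym (TEqvAddl _ _ _)) _.
by rewrite addNr; exact: TEqvZero.
Qed.

HB.instance Definition _ := GRing.isZmodule.Build tensor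
  tensor_addA tensor_addC tensor_add0 tensor_addN.

Lemma tensor_scaleA k l x :
  tensor_scale k (tensor_scale l x) = tensor_scale (k * l) x.
Proof.
case: (tensor_piP x) => s ->; rewrite !tensor_scale_pi /tensor_scale_seq -map_comp.
by congr (\pi_tensor _); apply: eq_map => p /=; rewrite scalerA.
Qed.

Lemma tensor_scale1 : left_id 1 tensor_scale.
Proof.
move=> x; case: (tensor_piP x) => s ->; rewrite tensor_scale_pi.
congr (\pi_tensor _); rewrite /tensor_scale_seq -[RHS]map_id.
by apply: eq_map => -[v w]; rewrite scale1r.
Qed.

Lemma tensor_scaleDr : right_distributive tensor_scale +%R.
Proof.
move=> k x y; case: (tensor_piP x) (tensor_piP y) => s -> [t ->].
rewrite /GRing.add /= tensor_add_pi !tensor_scale_pi tensor_add_pi.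
by rewrite /tensor_scale_seq map_cat.
Qed.

Lemma tensor_scaleDl x : {morph tensor_scale^~ x : k l / k + l}.
Proof.
move=> k l; case: (tensor_piP x) => s ->; rewrite !tensor_scale_pi.
elim: s => [|[v w] s IHs]; first by rewrite [RHS]tensor_add_pi.
rewrite -[(v, w) :: s]cat1s /tensor_scale_seq !map_cat -!tensor_add_pi.
have {}IHs := IHs : _ = tensor_add _ _.
rewrite IHs.
have -> : \pi_tensor [seq ((k + l) *: p.1, p.2) | p <- [:: (v, w)]]
  = (\pi_tensor [seq (k *: p.1, p.2) | p <- [:: (v, w)]] : tensor)
    + \pi_tensor [seq (l *: p.1, p.2) | p <- [:: (v, w)]].
  rewrite [RHS]tensor_add_pi /= scalerDl; apply: tensor_eqP; exact: TEqvAddl.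
exact: addrACA.
Qed.

HB.instance Definition _ := GRing.Zmodule_isLmodule.Build K tensor
  tensor_scaleA tensor_scale1 tensor_scaleDr tensor_scaleDl.

Lemma pure_bilinear : is_bilinear pure.
Proof.
split=> [w k v v' | v k w w'].
- rewrite [RHS](_ : _ = tensor_add (tensor_scale k (pure v w)) (pure v' w)) //.
  rewrite tensor_scale_pi tensor_add_pi; apply: tensor_eqP; exact: TEqvAddl.
- rewrite [RHS](_ : _ = tensor_add (tensor_scale k (pure v w)) (pure v w')) //.
  rewrite tensor_scale_pi tensor_add_pi; apply: tensor_eqP.
  apply: TEqvTrans (TEqvAddr _ _ _) _.
  apply: (@TEqvCat [:: (v, k *: w)] _ [:: (v, w')]); last exact: TEqvRefl.
  by apply: TEqvSym; exact: TEqvScale.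
Qed.

Lemma tensor_ind (P : tensor -> Prop) : (forall v w, P (pure v w)) ->
  (forall x y, P x -> P y -> P (x + y)) -> forall x, P x.
Proof.
move=> Pp PD x; case: (tensor_piP x) => s ->; elim: s => [|[v w] s IHs].
  by have := Pp 0 0; rewrite /pure (tensor_eqP (TEqvZero _)).
by have := PD _ _ (Pp v w) IHs; rewrite /GRing.add /= tensor_add_pi.
Qed.

(* The map induced by f on the tensor product; meaningful only for bilinear f,
   see tlift_pure, tlift_linear and tensor_ext. *)
Definition tlift (U : lmodType K) (f : V -> W -> U) (x : tensor) : U :=
  \sum_(p <- repr x) f p.1 p.2.

Section Lift.
Variables (U : lmodType K) (f : V -> W -> U).
Hypothesis f_bilin : is_bilinear f.

Lemma tlift_eqv s t : tensor_eqv s t ->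
  \sum_(p <- s) f p.1 p.2 = \sum_(p <- t) f p.1 p.2.
Proof.
case: f_bilin => fl fr; elim=> {s t}.
- by [].
- by move=> s t _ ->.
- by move=> s t u _ -> _ ->.
- by move=> s s' t t' _ E1 _ E2; rewrite !big_cat /= E1 E2.
- by move=> s t; rewrite !big_cat /= addrC.
- by move=> w; rewrite !big_cons !big_nil addr0 /= (lin0 (fl w)).
- by move=> v v' w; rewrite !big_cons !big_nil !addr0 /= (linD (fl w)).
- by move=> v w w'; rewrite !big_cons !big_nil !addr0 /= (linD (fr v)).
- by move=> k v w; rewrite !big_seq1 (linZ (fl w)) (linZ (fr v)).
Qed.

Lemma tlift_pi s : tlift f (\pi_tensor s) = \sum_(p <- s) f p.1 p.2.
Proof. by apply: tlift_eqv; exact: tensor_reprP. Qed.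

Lemma tlift_pure v w : tlift f (pure v w) = f v w.
Proof. by rewrite tlift_pi big_cons big_nil addr0. Qed.

Lemma tlift_linear : linear (tlift f).
Proof.
move=> k x y; case: (tensor_piP x) (tensor_piP y) => s -> [t ->].
have -> : k *: (\pi_tensor s : tensor) + \pi_tensor t
    = \pi_tensor (tensor_scale_seq k s ++ t).
  by rewrite /GRing.add /GRing.scale /= tensor_scale_pi tensor_add_pi.
rewrite !tlift_pi big_cat big_map /=; congr (_ + _).
by rewrite scaler_sumr; apply: eq_bigr => p _; rewrite (linZ (f_bilin.1 _)).
Qed.
End Lift.

Lemma tensor_ext (U : lmodType K) (f g : tensor -> U) : linear f -> linear g ->
  (forall v w, f (pure v w) = g (pure v w)) -> f =1 g.
Proof.
by move=> fl gl fg; apply: tensor_ind => // x y; rewrite (linD fl) (linD gl) => -> ->.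
Qed.
End TensorDef.

Arguments tensor {K} (V W)%_type_scope.
Notation "V ⊗ W" := (tensor V W) (at level 40, left associativity) : type_scope.
Notation "v ⊗ w" := (pure v w) (at level 40, left associativity) : ring_scope.

Section TensorMaps.
Variable K : fieldType.
Implicit Types U V W X : lmodType K.

Lemma tlift_comb V W U k (f f1 f2 : V -> W -> U) :
  (forall v w, f v w = k *: f1 v w + f2 v w) ->
  forall x, tlift f x = k *: tlift f1 x + tlift f2 x.
Proof.
move=> ff x; rewrite /tlift scaler_sumr -big_split /=.
by apply: eq_bigr => p _; exact: ff.
Qed.

Definition tmap V V' W W' (f : V -> V') (g : W -> W') : V ⊗ W -> V' ⊗ W' :=
  tlift (fun v w => f v ⊗ g w).

Lemma tmap_bilinear V V' W W' (f : V -> V') (g : W -> W') :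
  linear f -> linear g -> is_bilinear (fun v w => f v ⊗ g w).
Proof.
move=> fl gl; split=> [w|v] k x y /=.
- by rewrite fl (pure_bilinear V' W').1.
- by rewrite gl (pure_bilinear V' W').2.
Qed.

Lemma tmap_pure V V' W W' (f : V -> V') (g : W -> W') :
  linear f -> linear g -> forall v w, tmap f g (v ⊗ w) = f v ⊗ g w.
Proof. by move=> fl gl v w; rewrite /tmap tlift_pure //; exact: tmap_bilinear. Qed.

Lemma tmap_linear V V' W W' (f : V -> V') (g : W -> W') :
  linear f -> linear g -> linear (tmap f g).
Proof. by move=> fl gl; apply: tlift_linear; exact: tmap_bilinear. Qed.

HB.instance Definition _ (V V' W W' : lmodType K) (f : {linear V -> V'}) (g : {linear W -> W'}) :=
  GRing.isLinear.Build K (V ⊗ W)%type (V' ⊗ W')%type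
  *:%R (tmap f g)
    (tmap_linear (linearP f) (linearP g)).

Lemma tmapE V V' W W' (f : {linear V -> V'}) (g : {linear W -> W'}) v w :
  tmap f g (v ⊗ w) = f v ⊗ g w.
Proof. by rewrite tmap_pure //; exact: linearP. Qed.

Lemma tmap_linl V V' W W' (g : W -> W') k (f f1 f2 : V -> V') :
  (forall v, f v = k *: f1 v + f2 v) ->
  forall x, tmap f g x = k *: tmap f1 g x + tmap f2 g x.
Proof.
by move=> ff x; apply: tlift_comb => v w; rewrite ff (pure_bilinear V' W').1.
Qed.

Lemma tmap_linr V V' W W' (f : V -> V') k (g g1 g2 : W -> W') :
  (forall w, g w = k *: g1 w + g2 w) ->
  forall x, tmap f g x = k *: tmap f g1 x + tmap f g2 x.
Proof.
by move=> gg x; apply: tlift_comb => v w; rewrite gg (pure_bilinear V' W').2.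
Qed.

Definition tassoc U V W : (U ⊗ V) ⊗ W -> U ⊗ (V ⊗ W) :=
  tlift (fun x w => tlift (fun u v => u ⊗ (v ⊗ w)) x).

Definition tassoc_inv U V W : U ⊗ (V ⊗ W) -> (U ⊗ V) ⊗ W :=
  tlift (fun u y => tlift (fun v w => u ⊗ v ⊗ w) y).

Definition tlunit V : K^o ⊗ V -> V := tlift (fun (k : K^o) v => (k : K) *: v).
Definition trunit V : V ⊗ K^o -> V := tlift (fun v (k : K^o) => (k : K) *: v).

Lemma tassoc_bilin1 U V W w : is_bilinear (fun (u : U) (v : V) => u ⊗ (v ⊗ w : V ⊗ W)).
Proof.
split=> [v|u] k x y.
- exact: (pure_bilinear _ _).1.
- by rewrite (pure_bilinear V W).1 (pure_bilinear _ _).2.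
Qed.

Lemma tassoc_bilin U V W :
  is_bilinear (fun x (w : W) => tlift (fun (u : U) (v : V) => u ⊗ (v ⊗ w)) x).
Proof.
split=> [w|x] k y z.
- by apply: tlift_linear; exact: tassoc_bilin1.
- apply: tlift_comb => u v.
  by rewrite (pure_bilinear V W).2 (pure_bilinear _ _).2.
Qed.

Lemma tassoc_inv_bilin1 U V W u : is_bilinear (fun (v : V) (w : W) => (u ⊗ v : U ⊗ V) ⊗ w).
Proof.
split=> [w|v] k x y.
- by rewrite (pure_bilinear U V).2 (pure_bilinear _ _).1.
- exact: (pure_bilinear _ _).2.
Qed.

Lemma tassoc_inv_bilin U V W :
  is_bilinear (fun u (y : V ⊗ W) => tlift (fun v w => (u ⊗ v : U ⊗ V) ⊗ w) y).
Proof.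
split=> [x|u] k y z.
- apply: tlift_comb => v w.
  by rewrite (pure_bilinear U V).1 (pure_bilinear _ _).1.
- by apply: tlift_linear; exact: tassoc_inv_bilin1.
Qed.

Lemma tlunit_bilin V : is_bilinear (fun (k : K^o) (v : V) => (k : K) *: v).
Proof.
split=> [v|k] l x y.
- by rewrite scalerDl scalerA.
- by rewrite scalerDr !scalerA mulrC.
Qed.

Lemma trunit_bilin V : is_bilinear (fun (v : V) (k : K^o) => (k : K) *: v).
Proof. by split=> [k|v]; have [] := tlunit_bilin V. Qed.

Lemma tassocE U V W (u : U) (v : V) (w : W) : tassoc (u ⊗ v ⊗ w) = u ⊗ (v ⊗ w).
Proof.
rewrite /tassoc tlift_pure; last exact: tassoc_bilin.
by rewrite tlift_pure //; exact: tassoc_bilin1.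
Qed.

Lemma tassoc_invE U V W (u : U) (v : V) (w : W) :
  tassoc_inv (u ⊗ (v ⊗ w)) = u ⊗ v ⊗ w.
Proof.
rewrite /tassoc_inv tlift_pure; last exact: tassoc_inv_bilin.
by rewrite tlift_pure //; exact: tassoc_inv_bilin1.
Qed.

Lemma tlunitE V (k : K^o) (v : V) : tlunit (k ⊗ v) = (k : K) *: v.
Proof. by rewrite /tlunit tlift_pure //; exact: tlunit_bilin. Qed.

Lemma trunitE V (k : K^o) (v : V) : trunit (v ⊗ k) = (k : K) *: v.
Proof. by rewrite /trunit tlift_pure //; exact: trunit_bilin. Qed.

HB.instance Definition _ (U V W : lmodType K) :=
  GRing.isLinear.Build K ((U ⊗ V) ⊗ W)%type (U ⊗ (V ⊗ W))%type
  *:%R (@tassoc U V W) (tlift_linear (@tassoc_bilin U V W)).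
HB.instance Definition _ (U V W : lmodType K) :=
  GRing.isLinear.Build K (U ⊗ (V ⊗ W))%type ((U ⊗ V) ⊗ W)%type
  *:%R (@tassoc_inv U V W) (tlift_linear (@tassoc_inv_bilin U V W)).
HB.instance Definition _ (V : lmodType K) := GRing.isLinear.Build K (K^o ⊗ V)%type V
  *:%R (@tlunit V) (tlift_linear (@tlunit_bilin V)).
HB.instance Definition _ (V : lmodType K) := GRing.isLinear.Build K (V ⊗ K^o)%type V
  *:%R (@trunit V) (tlift_linear (@trunit_bilin V)).

Definition tlunit_inv V (v : V) : K^o ⊗ V := (1 : K^o) ⊗ v.
Definition trunit_inv V (v : V) : V ⊗ K^o := v ⊗ (1 : K^o).
HB.instance Definition _ (V : lmodType K) := GRing.isLinear.Build K V (K^o ⊗ V)%type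
  *:%R (@tlunit_inv V) ((pure_bilinear _ _).2 1).
HB.instance Definition _ (V : lmodType K) := GRing.isLinear.Build K V (V ⊗ K^o)%type
  *:%R (@trunit_inv V) ((pure_bilinear _ _).1 1).

Lemma pure_linl U V v : linear (fun u : U => u ⊗ v : U ⊗ V).
Proof. exact: (pure_bilinear _ _).1. Qed.

Lemma pure_linr U V u : linear (fun v : V => u ⊗ v : U ⊗ V).
Proof. exact: (pure_bilinear _ _).2. Qed.

Lemma tensor_ext3 U V W X (f g : (U ⊗ V) ⊗ W -> X) : linear f -> linear g ->
  (forall u v w, f (u ⊗ v ⊗ w) = g (u ⊗ v ⊗ w)) -> f =1 g.
Proof.
move=> fl gl fg; apply: tensor_ext => // x w; move: x; apply: tensor_ext => //.
- by apply: (lin_comp fl); exact: pure_linl.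
- by apply: (lin_comp gl); exact: pure_linl.
Qed.

Lemma tensor_ext3r U V W X (f g : U ⊗ (V ⊗ W) -> X) : linear f -> linear g ->
  (forall u v w, f (u ⊗ (v ⊗ w)) = g (u ⊗ (v ⊗ w))) -> f =1 g.
Proof.
move=> fl gl fg; apply: tensor_ext => // u x; move: x; apply: tensor_ext => //.
- by apply: (lin_comp fl); exact: pure_linr.
- by apply: (lin_comp gl); exact: pure_linr.
Qed.

Lemma tensor_ext4 U V W Y X (f g : ((U ⊗ V) ⊗ W) ⊗ Y -> X) : linear f -> linear g ->
  (forall u v w y, f (u ⊗ v ⊗ w ⊗ y) = g (u ⊗ v ⊗ w ⊗ y)) -> f =1 g.
Proof.
move=> fl gl fg; apply: tensor_ext3 => // x w y; move: x; apply: tensor_ext => //.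
- by apply: (lin_comp fl); apply: (lin_comp (@pure_linl _ _ y)); exact: pure_linl.
- by apply: (lin_comp gl); apply: (lin_comp (@pure_linl _ _ y)); exact: pure_linl.
Qed.

Lemma tassocK U V W : cancel (@tassoc U V W) (@tassoc_inv U V W).
Proof.
apply: tensor_ext3 => //; last by move=> u v w; rewrite tassocE tassoc_invE.
exact: (linearP (@tassoc_inv U V W \o @tassoc U V W)).
Qed.

Lemma tassoc_invK U V W : cancel (@tassoc_inv U V W) (@tassoc U V W).
Proof.
apply: tensor_ext3r => //; last by move=> u v w; rewrite tassoc_invE tassocE.
exact: (linearP (@tassoc U V W \o @tassoc_inv U V W)).
Qed.

Lemma tlunitK V : cancel (@tlunit V) (@tlunit_inv V).
Proof.
apply: tensor_ext => // [|k v]; first exact: (linearP (@tlunit_inv V \o @tlunit V)).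
rewrite tlunitE /tlunit_inv (linZ (@pure_linr _ _ _)) -(linZ (@pure_linl _ _ _)) /=.
by rewrite [_ *: _]mulr1.
Qed.

Lemma tlunit_invK V : cancel (@tlunit_inv V) (@tlunit V).
Proof. by move=> v; rewrite tlunitE scale1r. Qed.

Lemma trunitK V : cancel (@trunit V) (@trunit_inv V).
Proof.
apply: tensor_ext => // [|v k]; first exact: (linearP (@trunit_inv V \o @trunit V)).
rewrite trunitE /trunit_inv (linZ (@pure_linl _ _ _)) -(linZ (@pure_linr _ _ _)) /=.
by rewrite [_ *: _]mulr1.
Qed.

Lemma trunit_invK V : cancel (@trunit_inv V) (@trunit V).
Proof. by move=> v; rewrite trunitE scale1r. Qed.
End TensorMaps.

(* The Lie algebra h ⊗ A, with bracket [g ⊗ a, g' ⊗ b] = [g, g'] ⊗ ab. *)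
Section TensorLie.
Variables (K : fieldType) (h : lieAlgType K) (A : ucomAlgType K).

Definition tlie (s t : h ⊗ A) : h ⊗ A :=
  tlift (fun g a => tlift (fun g' b => lie g g' ⊗ amul a b) t) s.

Lemma amul_linearl (b : A) : linear (amul^~ b).
Proof. by move=> k x y; rewrite !(amulC _ b) amul_linear. Qed.

Lemma tlie_bilin1 g (a : A) : is_bilinear (fun g' b => lie g g' ⊗ amul a b : h ⊗ A).
Proof.
split=> [b|g'] k x y.
- by rewrite lie_linearr (pure_bilinear _ _).1.
- by rewrite amul_linear (pure_bilinear _ _).2.
Qed.

Lemma tlie_bilin t :
  is_bilinear (fun g (a : A) => tlift (fun g' b => lie g g' ⊗ amul a b : h ⊗ A) t).
Proof.
split=> [a|g] k x y; apply: tlift_comb => g' b.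
- by rewrite lie_linearl (pure_bilinear _ _).1.
- by rewrite amul_linearl (pure_bilinear _ _).2.
Qed.

Lemma tlieE g a g' b : tlie (g ⊗ a) (g' ⊗ b) = lie g g' ⊗ amul a b.
Proof.
rewrite /tlie tlift_pure; last exact: tlie_bilin.
by rewrite tlift_pure //; exact: tlie_bilin1.
Qed.

Lemma tlie_linearl t : linear (tlie^~ t).
Proof. by apply: tlift_linear; exact: tlie_bilin. Qed.

Lemma tlie_linearr s : linear (tlie s).
Proof.
move=> k x y; apply: tlift_comb => g a.
by apply: tlift_linear; exact: tlie_bilin1.
Qed.

Lemma lie_anti (L : lieAlgType K) (x y : L) : lie x y = - lie y x.
Proof.
apply/eqP; rewrite -addr_eq0; apply/eqP; have := liexx (x + y).
rewrite (linD (lie_linearl _)) !(linD (lie_linearr _)) !liexx.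
by rewrite add0r addr0.
Qed.

Lemma tlie_anti s t : tlie s t = - tlie t s.
Proof.
elim/tensor_ind: s => [g a|x y IHx IHy]; last first.
  by rewrite (linD (tlie_linearl _)) (linD (tlie_linearr _)) IHx IHy opprD.
elim/tensor_ind: t => [g' b|x y IHx IHy]; last first.
  by rewrite (linD (tlie_linearl _)) (linD (tlie_linearr _)) IHx IHy opprD.
by rewrite !tlieE lie_anti amulC (linN (@pure_linl _ _ _ _)).
Qed.

Lemma tliexx s : tlie s s = 0.
Proof.
elim/tensor_ind: s => [g a|x y IHx IHy].
  by rewrite tlieE liexx (lin0 (@pure_linl _ _ _ _)).
rewrite (linD (tlie_linearl _)) !(linD (tlie_linearr _)) IHx IHy.
by rewrite add0r addr0 tlie_anti addNr.
Qed.

Let jac x y z := tlie x (tlie y z) + tlie y (tlie z x) + tlie z (tlie x y).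

Let jacC x y z : jac x y z = jac y z x.
Proof. by rewrite /jac -addrA addrC. Qed.

Let jacD x x' y z : jac (x + x') y z = jac x y z + jac x' y z.
Proof.
rewrite /jac (linD (tlie_linearl (tlie y z))) (linD (tlie_linearr z)).
rewrite (linD (tlie_linearl y)) !(linD (tlie_linearr _)).
by rewrite [RHS]addrACA; congr (_ + _); exact: addrACA.
Qed.

Lemma tlie_jacobi x y z : jac x y z = 0.
Proof.
elim/tensor_ind: x => [g a|x x' IHx IHx']; last by rewrite jacD IHx IHx' addr0.
rewrite jacC.
elim/tensor_ind: y => [g' b|x x' IHx IHx']; last by rewrite jacD IHx IHx' addr0.
rewrite jacC.
elim/tensor_ind: z => [g'' c|x x' IHx IHx']; last by rewrite jacD IHx IHx' addr0.
have E1 : amul b (amul c a) = amul a (amul b c) by rewrite amulA amulC.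
have E2 : amul c (amul a b) = amul a (amul b c) by rewrite amulC -amulA.
rewrite /jac !tlieE E1 E2 -!(linD (@pure_linl _ _ _ _)) lie_jacobi.
by rewrite (lin0 (@pure_linl _ _ _ _)).
Qed.
End TensorLie.

HB.instance Definition _ (K : fieldType) (h : lieAlgType K) (A : ucomAlgType K) :=
  Lmodule_isLieAlgebra.Build K (h ⊗ A)%type
    (@tlie_linearl K h A) (@tlie_linearr K h A) (@tliexx K h A) (@tlie_jacobi K h A).

Record category := Category {
  ob :> Type;
  hom : ob -> ob -> Type;
  idm : forall X, hom X X;
  compm : forall X Y Z, hom Y Z -> hom X Y -> hom X Z;
  comp1f : forall X Y (f : hom X Y), compm (idm Y) f = f;
  compf1 : forall X Y (f : hom X Y), compm f (idm X) = f;
  compA : forall X Y Z T (f : hom Z T) (g : hom Y Z) (e : hom X Y),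
    compm f (compm g e) = compm (compm f g) e
}.
Arguments idm {c} X.
Notation "g ∘ f" := (compm g f) (at level 40, left associativity).

Definition is_iso (C : category) (X Y : C) (f : hom X Y) : Prop :=
  exists g : hom Y X, g ∘ f = idm X /\ f ∘ g = idm Y.

Record bifunctor_data (C D E : category) := BifunctorData {
  bf_ob : C -> D -> E;
  bf_hom : forall X X' Y Y', hom X X' -> hom Y Y' -> hom (bf_ob X Y) (bf_ob X' Y')
}.

Record bifunctor (C D E : category) := Bifunctor {
  bf_data :> bifunctor_data C D E;
  bf_id : forall X Y, bf_hom bf_data (idm X) (idm Y) = idm (bf_ob bf_data X Y);
  bf_comp : forall X X' X'' Y Y' Y'' (f' : hom X' X'') (f : hom X X')
    (g' : hom Y' Y'') (g : hom Y Y'),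
    bf_hom bf_data (f' ∘ f) (g' ∘ g) = bf_hom bf_data f' g' ∘ bf_hom bf_data f g
}.

Record monoidal_category := MonoidalCategory {
  mc_cat :> category;
  mc_tens : bifunctor mc_cat mc_cat mc_cat;
  mc_unit : mc_cat;
  mc_assoc : forall X Y Z,
    hom (bf_ob mc_tens (bf_ob mc_tens X Y) Z) (bf_ob mc_tens X (bf_ob mc_tens Y Z));
  mc_assoc_iso : forall X Y Z, is_iso (mc_assoc X Y Z);
  mc_assoc_nat : forall X X' Y Y' Z Z' (f : hom X X') (g : hom Y Y') (e : hom Z Z'),
    mc_assoc X' Y' Z' ∘ bf_hom mc_tens (bf_hom mc_tens f g) e
    = bf_hom mc_tens f (bf_hom mc_tens g e) ∘ mc_assoc X Y Z;
  mc_lunit : forall X, hom (bf_ob mc_tens mc_unit X) X;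
  mc_lunit_iso : forall X, is_iso (mc_lunit X);
  mc_lunit_nat : forall X X' (f : hom X X'),
    mc_lunit X' ∘ bf_hom mc_tens (idm mc_unit) f = f ∘ mc_lunit X;
  mc_runit : forall X, hom (bf_ob mc_tens X mc_unit) X;
  mc_runit_iso : forall X, is_iso (mc_runit X);
  mc_runit_nat : forall X X' (f : hom X X'),
    mc_runit X' ∘ bf_hom mc_tens f (idm mc_unit) = f ∘ mc_runit X;
  mc_pentagon : forall X Y Z T,
    mc_assoc X Y (bf_ob mc_tens Z T) ∘ mc_assoc (bf_ob mc_tens X Y) Z T
    = bf_hom mc_tens (idm X) (mc_assoc Y Z T) ∘ mc_assoc X (bf_ob mc_tens Y Z) T
      ∘ bf_hom mc_tens (mc_assoc X Y Z) (idm T);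
  mc_triangle : forall X Y,
    bf_hom mc_tens (idm X) (mc_lunit Y) ∘ mc_assoc X mc_unit Y
    = bf_hom mc_tens (mc_runit X) (idm Y)
}.

Record left_module_structure (C : monoidal_category) (M : category) :=
  LeftModuleStructure {
  lm_act : bifunctor C M M;
  lm_assoc : forall (X Y : C) (N : M),
    hom (bf_ob lm_act (bf_ob (mc_tens C) X Y) N) (bf_ob lm_act X (bf_ob lm_act Y N));
  lm_assoc_iso : forall X Y N, is_iso (lm_assoc X Y N);
  lm_assoc_nat : forall (X X' Y Y' : C) (N N' : M)
    (f : hom X X') (g : hom Y Y') (e : hom N N'),
    lm_assoc X' Y' N' ∘ bf_hom lm_act (bf_hom (mc_tens C) f g) e
    = bf_hom lm_act f (bf_hom lm_act g e) ∘ lm_assoc X Y N;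
  lm_unit : forall N, hom (bf_ob lm_act (mc_unit C) N) N;
  lm_unit_iso : forall N, is_iso (lm_unit N);
  lm_unit_nat : forall (N N' : M) (f : hom N N'),
    lm_unit N' ∘ bf_hom lm_act (idm (mc_unit C)) f = f ∘ lm_unit N;
  lm_pentagon : forall (X Y Z : C) (N : M),
    lm_assoc X Y (bf_ob lm_act Z N) ∘ lm_assoc (bf_ob (mc_tens C) X Y) Z N
    = bf_hom lm_act (idm X) (lm_assoc Y Z N) ∘ lm_assoc X (bf_ob (mc_tens C) Y Z) N
      ∘ bf_hom lm_act (mc_assoc X Y Z) (idm N);
  lm_triangle : forall (X : C) (N : M),
    bf_hom lm_act (idm X) (lm_unit N) ∘ lm_assoc X (mc_unit C) N
    = bf_hom lm_act (mc_runit X) (idm N)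
}.

(* theta is a Lie algebra homomorphism from L to gl(V). *)
Definition is_lie_rep (K : fieldType) (L : lieAlgType K) (V : lmodType K)
    (theta : L -> V -> V) : Prop :=
  is_bilinear theta /\
  forall x y v, theta (lie x y) v = theta x (theta y v) - theta y (theta x v).

Lemma sub_addACA (V : zmodType) (a b c d : V) : (a - b) + (c - d) = (a + c) - (b + d).
Proof. by rewrite opprD addrACA. Qed.

Lemma addr_cross (V : zmodType) (a b c d e f : V) :
  (a - b) + (c - d) = (a + e) + (f + c) - ((b + f) + (e + d)).
Proof.
rewrite [in RHS]opprD !opprD [RHS]addrACA [a + e + _]addrACA [f + c + _]addrACA.
rewrite [(f - e) + _]addrC [RHS]addrACA [(e - f) + _]addrA subrK subrr addr0.
by [].
Qed.

Section Rep.
Variables (K : fieldType) (h : lieAlgType K).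

Record rep := Rep {
  rep_space :> lmodType K;
  rep_act : h -> rep_space -> rep_space;
  rep_axiom : is_lie_rep rep_act
}.

Record rep_hom (V V' : rep) := RepHom {
  rep_map :> {linear V -> V'};
  rep_map_equiv : forall x v, rep_map (rep_act x v) = rep_act x (rep_map v)
}.

Lemma rep_hom_eq (V V' : rep) (f g : rep_hom V V') : f =1 g -> f = g.
Proof.
case: f g => [f fE] [g gE] /= /linear_eq fg; subst g.
by congr RepHom; exact: Prop_irrelevance.
Qed.

Definition rep_id (V : rep) : rep_hom V V := @RepHom V V idfun (fun _ _ => erefl).

Lemma rep_comp_equiv (V V' V'' : rep) (g : rep_hom V' V'') (f : rep_hom V V') x v :
  (g \o f) (rep_act x v) = rep_act x ((g \o f) v).
Proof. by rewrite /= !rep_map_equiv. Qed.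

Definition rep_comp (V V' V'' : rep) (g : rep_hom V' V'') (f : rep_hom V V') :
  rep_hom V V'' := @RepHom V V'' (g \o f) (rep_comp_equiv g f).

Definition Rep_category : category.
Proof.
by refine (@Category rep rep_hom rep_id rep_comp _ _ _) => *; exact: rep_hom_eq.
Defined.

Definition rep_tensor_act (V W : rep) (x : h) (t : V ⊗ W) : V ⊗ W :=
  tmap (rep_act x) idfun t + tmap idfun (rep_act x) t.

Lemma rep_act_linear (V : rep) x : linear (@rep_act V x).
Proof. by case: (rep_axiom V) => -[]. Qed.

Lemma rep_act_linearl (V : rep) v : linear ((@rep_act V)^~ v).
Proof. by case: (rep_axiom V) => -[]. Qed.

Lemma rep_actE (V : rep) x y (v : V) :
  rep_act (lie x y) v = rep_act x (rep_act y v) - rep_act y (rep_act x v).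
Proof. by case: (rep_axiom V). Qed.

Lemma id_linear (V : lmodType K) : linear (@idfun V). Proof. by []. Qed.

Lemma rep_tensor_act_linear (V W : rep) x : linear (@rep_tensor_act V W x).
Proof.
apply: lin_add; apply: tmap_linear; by [exact: rep_act_linear | exact: id_linear].
Qed.

Lemma rep_tensor_actE (V W : rep) x (v : V) (w : W) :
  rep_tensor_act x (v ⊗ w) = rep_act x v ⊗ w + v ⊗ rep_act x w.
Proof.
by rewrite /rep_tensor_act !tmap_pure //; exact: rep_act_linear.
Qed.

Lemma rep_tensor_axiom (V W : rep) : is_lie_rep (@rep_tensor_act V W).
Proof.
split; first (split=> [t k x y|x]; last exact: rep_tensor_act_linear).
  rewrite /rep_tensor_act.
  rewrite (@tmap_linl _ _ _ _ _ _ k (rep_act (k *: x + y)) (rep_act x) (rep_act y));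
    last by move=> v; exact: rep_act_linearl.
  rewrite (@tmap_linr _ _ _ _ _ _ k (rep_act (k *: x + y)) (rep_act x) (rep_act y));
    last by move=> v; exact: rep_act_linearl.
  by rewrite scalerDr addrACA.
have D z (s t : V ⊗ W) : rep_tensor_act z (s + t) = rep_tensor_act z s + rep_tensor_act z t.
  exact: (linD (@rep_tensor_act_linear V W z)).
move=> x y; elim/tensor_ind => [v w|s t IHs IHt]; last first.
  rewrite (D _ s t) (D y s t) (D x s t) (D x (rep_tensor_act y s)).
  rewrite (D y (rep_tensor_act x s)) IHs IHt.
  exact: sub_addACA.
rewrite !rep_tensor_actE (D x (rep_act y v ⊗ w)) (D y (rep_act x v ⊗ w)).
rewrite !rep_tensor_actE !rep_actE.
rewrite (linB (@pure_linl _ _ _ _)) (linB (@pure_linr _ _ _ _)).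
exact: addr_cross.
Qed.

Definition rep_tensor (V W : rep) : rep := Rep (rep_tensor_axiom V W).

Lemma rep_hom_eq2 (V W X : rep) (f g : rep_hom (rep_tensor V W) X) :
  (forall (v : V) (w : W), f (v ⊗ w) = g (v ⊗ w)) -> f = g.
Proof. by move=> fg; apply: rep_hom_eq; apply: tensor_ext => //; exact: linearP. Qed.

Lemma rep_hom_eq3 (V W X Y : rep) (f g : rep_hom (rep_tensor (rep_tensor V W) X) Y) :
  (forall (v : V) (w : W) (x : X), f (v ⊗ w ⊗ x) = g (v ⊗ w ⊗ x)) -> f = g.
Proof. by move=> fg; apply: rep_hom_eq; apply: tensor_ext3 => //; exact: linearP. Qed.

Lemma rep_hom_eq3r (V W X Y : rep) (f g : rep_hom (rep_tensor V (rep_tensor W X)) Y) :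
  (forall (v : V) (w : W) (x : X), f (v ⊗ (w ⊗ x)) = g (v ⊗ (w ⊗ x))) -> f = g.
Proof. by move=> fg; apply: rep_hom_eq; apply: tensor_ext3r => //; exact: linearP. Qed.

Lemma rep_hom_eq4 (V W X Y Z : rep)
    (f g : rep_hom (rep_tensor (rep_tensor (rep_tensor V W) X) Y) Z) :
  (forall (v : V) (w : W) (x : X) (y : Y), f (v ⊗ w ⊗ x ⊗ y) = g (v ⊗ w ⊗ x ⊗ y)) ->
  f = g.
Proof. by move=> fg; apply: rep_hom_eq; apply: tensor_ext4 => //; exact: linearP. Qed.

Lemma equiv_linl (V W : rep) (f : {linear V -> W}) x :
  linear (fun v => f (rep_act x v)).
Proof. exact: (lin_comp (linearP f) (@rep_act_linear V x)). Qed.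

Lemma equiv_linr (V W : rep) (f : {linear V -> W}) x :
  linear (fun v => rep_act x (f v)).
Proof. exact: (lin_comp (@rep_act_linear W x) (linearP f)). Qed.

Lemma rep_tensor_hom_equiv (V V' W W' : rep) (f : rep_hom V V') (g : rep_hom W W')
    x (t : V ⊗ W) :
  tmap f g (rep_tensor_act x t) = rep_tensor_act x (tmap f g t).
Proof.
move: t; apply: tensor_ext.
- exact: (@equiv_linl (rep_tensor V W) (rep_tensor V' W') (tmap f g)).
- exact: (@equiv_linr (rep_tensor V W) (rep_tensor V' W') (tmap f g)).
move=> v w; rewrite rep_tensor_actE tmapE rep_tensor_actE -!rep_map_equiv.
by rewrite linearD /= !tmapE.
Qed.

Definition rep_tensor_hom (V V' W W' : rep) (f : rep_hom V V') (g : rep_hom W W') :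
  rep_hom (rep_tensor V W) (rep_tensor V' W') :=
  @RepHom (rep_tensor V W) (rep_tensor V' W') (tmap f g) (rep_tensor_hom_equiv f g).

Definition rep_tensor_data : bifunctor_data Rep_category Rep_category Rep_category :=
  @BifunctorData Rep_category Rep_category Rep_category rep_tensor rep_tensor_hom.

Definition rep_tensor_bifunctor : bifunctor Rep_category Rep_category Rep_category.
Proof.
refine (@Bifunctor _ _ _ rep_tensor_data _ _).
- by move=> V W; apply: rep_hom_eq2 => v w; rewrite /= tmapE.
- by move=> *; apply: rep_hom_eq2 => v w; rewrite /= !tmapE.
Defined.

Lemma rep_trivial_axiom : @is_lie_rep K h K^o (fun _ _ => 0).
Proof.
by split; [split=> [v|x] k y z; rewrite scaler0 addr0 | move=> x y v; rewrite subr0].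
Qed.

Definition rep_trivial : rep := Rep rep_trivial_axiom.

Lemma rep_assoc_equiv (U V W : rep) x (t : (U ⊗ V) ⊗ W) :
  tassoc (@rep_tensor_act (rep_tensor U V) W x t)
  = @rep_tensor_act U (rep_tensor V W) x (tassoc t).
Proof.
move: t; apply: tensor_ext3.
- exact: (@equiv_linl (rep_tensor (rep_tensor U V) W) (rep_tensor U (rep_tensor V W))
    (@tassoc K U V W)).
- exact: (@equiv_linr (rep_tensor (rep_tensor U V) W) (rep_tensor U (rep_tensor V W))
    (@tassoc K U V W)).
move=> u v w; rewrite tassocE !rep_tensor_actE /= !rep_tensor_actE.
rewrite (linD (@pure_linl _ _ _ w)) (linD (@pure_linr _ _ _ u)).
by rewrite !linearD /= !tassocE addrA.
Qed.

Definition rep_assoc (U V W : rep) :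
  rep_hom (rep_tensor (rep_tensor U V) W) (rep_tensor U (rep_tensor V W)) :=
  @RepHom (rep_tensor (rep_tensor U V) W) (rep_tensor U (rep_tensor V W))
    (@tassoc K U V W) (@rep_assoc_equiv U V W).

Lemma rep_lunit_equiv (V : rep) x (t : K^o ⊗ V) :
  tlunit (@rep_tensor_act rep_trivial V x t) = rep_act x (tlunit t).
Proof.
move: t; apply: tensor_ext.
- exact: (@equiv_linl (rep_tensor rep_trivial V) V (@tlunit K V)).
- exact: (@equiv_linr (rep_tensor rep_trivial V) V (@tlunit K V)).
move=> k v; rewrite rep_tensor_actE linearD /= !tlunitE scale0r add0r.
by rewrite (linZ (@rep_act_linear V x)).
Qed.

Definition rep_lunit (V : rep) : rep_hom (rep_tensor rep_trivial V) V :=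
  @RepHom (rep_tensor rep_trivial V) V (@tlunit K V) (@rep_lunit_equiv V).

Lemma rep_runit_equiv (V : rep) x (t : V ⊗ K^o) :
  trunit (@rep_tensor_act V rep_trivial x t) = rep_act x (trunit t).
Proof.
move: t; apply: tensor_ext.
- exact: (@equiv_linl (rep_tensor V rep_trivial) V (@trunit K V)).
- exact: (@equiv_linr (rep_tensor V rep_trivial) V (@trunit K V)).
move=> v k; rewrite rep_tensor_actE linearD /= !trunitE scale0r addr0.
by rewrite (linZ (@rep_act_linear V x)).
Qed.

Definition rep_runit (V : rep) : rep_hom (rep_tensor V rep_trivial) V :=
  @RepHom (rep_tensor V rep_trivial) V (@trunit K V) (@rep_runit_equiv V).

Lemma rep_iso (V W : rep) (f : rep_hom V W) (g : {linear W -> V}) :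
  cancel f g -> cancel g f -> @is_iso Rep_category V W f.
Proof.
move=> fK gK.
have gE x (w : W) : g (rep_act x w) = rep_act x (g w).
  by apply: (can_inj fK); rewrite rep_map_equiv !gK.
by exists (RepHom gE); split; apply: rep_hom_eq => v /=; rewrite ?fK ?gK.
Qed.

Lemma rep_assoc_iso (U V W : rep) : @is_iso Rep_category _ _ (rep_assoc U V W).
Proof.
apply: (@rep_iso (rep_tensor (rep_tensor U V) W) (rep_tensor U (rep_tensor V W))
  (rep_assoc U V W) (@tassoc_inv K U V W)); [exact: tassocK | exact: tassoc_invK].
Qed.

Lemma rep_lunit_iso (V : rep) : @is_iso Rep_category _ _ (rep_lunit V).
Proof.
apply: (@rep_iso (rep_tensor rep_trivial V) V (rep_lunit V) (@tlunit_inv K V)).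
- exact: tlunitK.
- exact: tlunit_invK.
Qed.

Lemma rep_runit_iso (V : rep) : @is_iso Rep_category _ _ (rep_runit V).
Proof.
apply: (@rep_iso (rep_tensor V rep_trivial) V (rep_runit V) (@trunit_inv K V)).
- exact: trunitK.
- exact: trunit_invK.
Qed.

Definition Rep_monoidal : monoidal_category.
Proof.
refine (@MonoidalCategory Rep_category rep_tensor_bifunctor rep_trivial
  rep_assoc rep_assoc_iso _ rep_lunit rep_lunit_iso _ rep_runit rep_runit_iso _ _ _).
- by move=> *; apply: rep_hom_eq3 => u v w; do !rewrite /= ?tassocE ?tmapE.
- by move=> *; apply: rep_hom_eq2 => k v; rewrite /= tmapE /= !tlunitE linearZ.
- by move=> *; apply: rep_hom_eq2 => v k; rewrite /= tmapE /= !trunitE linearZ.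
- by move=> *; apply: rep_hom_eq4 => u v w x; do !rewrite /= ?tassocE ?tmapE.
- move=> *; apply: rep_hom_eq3 => u k v; rewrite /= tassocE !tmapE /= tlunitE trunitE.
  by rewrite (linZ (@pure_linl _ _ _ _)) (linZ (@pure_linr _ _ _ _)).
Defined.
End Rep.

Arguments rep_act {K h} r x v : rename.

Section LeibnizPair.
Variables (K : fieldType) (A : ucomAlgType K).

Definition is_derivation (D : A -> A) : Prop :=
  linear D /\ forall a b, D (amul a b) = amul (D a) b + amul a (D b).

(* The anchor is a Lie algebra homomorphism from lp_lie to Der(A), a subalgebra
   of gl(A). *)
Record leibniz_pair := LeibnizPair {
  lp_lie :> lieAlgType K;
  anchor : lp_lie -> A -> A;
  anchor_rep : is_lie_rep anchor;
  anchor_der : forall x, is_derivation (anchor x)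
}.

Definition is_module (M : lmodType K) (smul : A -> M -> M) : Prop :=
  [/\ is_bilinear smul,
      forall a b m, smul (amul a b) m = smul a (smul b m)
    & forall m, smul aone m = m].

Variable S : leibniz_pair.

Definition is_admissible (M : lmodType K) (smul : A -> M -> M) (rho : S -> M -> M) :
    Prop :=
  [/\ is_module smul, is_lie_rep rho
    & forall x a m, rho x (smul a m) = smul a (rho x m) + smul (anchor x a) m].

Record arep := ARep {
  arep_space :> lmodType K;
  arep_smul : A -> arep_space -> arep_space;
  arep_act : S -> arep_space -> arep_space;
  arep_axiom : is_admissible arep_smul arep_act
}.

Arguments arep_smul : clear implicits.
Arguments arep_act : clear implicits.

Definition is_arep_hom (M M' : lmodType K) (smul : A -> M -> M) (rho : S -> M -> M)
    (smul' : A -> M' -> M') (rho' : S -> M' -> M') (phi : M -> M') : Prop :=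
  (forall a m, phi (smul a m) = smul' a (phi m)) /\
  (forall x m, phi (rho x m) = rho' x (phi m)).

Record arep_hom (M M' : arep) := ARepHom {
  arep_map :> {linear M -> M'};
  arep_map_axiom : is_arep_hom (arep_smul M) (arep_act M)
    (arep_smul M') (arep_act M') arep_map
}.

Lemma arep_hom_eq (M M' : arep) (f g : arep_hom M M') : f =1 g -> f = g.
Proof.
case: f g => [f fE] [g gE] /= /linear_eq fg; subst g.
by congr ARepHom; exact: Prop_irrelevance.
Qed.

Definition arep_id (M : arep) : arep_hom M M :=
  @ARepHom M M idfun (conj (fun _ _ => erefl) (fun _ _ => erefl)).

Lemma arep_comp_axiom (M M' M'' : arep) (g : arep_hom M' M'') (f : arep_hom M M') :
  is_arep_hom (arep_smul M) (arep_act M) (arep_smul M'') (arep_act M'') (g \o f).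
Proof.
case: f g => [f [f1 f2]] [g [g1 g2]].
by split=> /= x m; rewrite ?f1 ?f2 ?g1 ?g2.
Qed.

Definition arep_comp (M M' M'' : arep) (g : arep_hom M' M'') (f : arep_hom M M') :
  arep_hom M M'' := @ARepHom M M'' (g \o f) (arep_comp_axiom g f).

Definition ARep_category : category.
Proof.
by refine (@Category arep arep_hom arep_id arep_comp _ _ _) => *; exact: arep_hom_eq.
Defined.

Variable h : lieAlgType K.

Definition coef_act (x : S) : h ⊗ A -> h ⊗ A := tmap idfun (anchor x).

Definition crossed_hom (H : S -> h ⊗ A) : Prop :=
  linear H /\
  forall x y,
    H (lie x y) = coef_act x (H y) - coef_act y (H x) + lie (H x) (H y).

(* The map from S to the underlying space of the semidirect product of S and h ⊗ A. *)
Definition iota_graph (H : S -> h ⊗ A) (x : S) : S * (h ⊗ A) := (x, H x).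

Variables (V : rep h) (M : arep).

Definition tensor_smul (a : A) : V ⊗ M -> V ⊗ M := tmap idfun (arep_smul M a).

(* See boxplusE for the value at (x, g ⊗ a) and v ⊗ m. *)
Definition boxplus (p : S * (h ⊗ A)) (u : V ⊗ M) : V ⊗ M :=
  tmap idfun (arep_act M p.1) u
  + tlift (fun g a => tmap (rep_act V g) (arep_smul M a) u) p.2.

Lemma tensor_smulE a (v : V) (m : M) : tensor_smul a (v ⊗ m) = v ⊗ arep_smul M a m.
Proof.
by rewrite /tensor_smul tmap_pure //; case: (arep_axiom M) => -[[]].
Qed.

Lemma boxplus_bilin u :
  is_bilinear (fun (g : h) (a : A) => tmap (rep_act V g) (arep_smul M a) u).
Proof.
case: (rep_axiom V) (arep_axiom M) => -[tl _] _ [[[sl _] _ _] _ _].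
split=> [a|g] k x y; [apply: tmap_linl | apply: tmap_linr] => w; [exact: tl | exact: sl].
Qed.

Lemma boxplusE x g a (v : V) (m : M) :
  boxplus (x, g ⊗ a) (v ⊗ m) = v ⊗ arep_act M x m + rep_act V g v ⊗ arep_smul M a m.
Proof.
rewrite /boxplus tlift_pure; last exact: boxplus_bilin.
case: (rep_axiom V) (arep_axiom M) => -[_ tl] _ [[[_ sl] _ _] [[_ al] _] _].
by rewrite !tmap_pure.
Qed.

Lemma boxplus_linear p : linear (boxplus p).
Proof.
case: (rep_axiom V) (arep_axiom M) => -[_ tl] _ [[[_ sl] _ _] [[_ al] _] _].
apply: lin_add; first by apply: tmap_linear.
by move=> k x y; apply: tlift_comb => g a; apply: tmap_linear.
Qed.
End LeibnizPair.

Arguments arep_smul {K A S} M a m : rename.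
Arguments arep_act {K A S} M x m : rename.
Arguments ARep {K A S arep_space arep_smul arep_act} arep_axiom.
Arguments ARepHom {K A S M M'} arep_map arep_map_axiom.
Arguments iota_graph {K A S h} H x.
Arguments tensor_smul {K A S h} V M a u.
Arguments boxplus {K A S h} V M p u.

(* Main.v *)
(* The semidirect product acts on V ⊗ M by the sum of id ⊗ rho(x) and an action of
   the Lie algebra h ⊗ A, which commutes with A.  Because M is admissible, the
   commutator of id ⊗ rho(x) with the action of s in h ⊗ A is the action of x . s;
   the crossed homomorphism identity is then exactly what makes x |-> (x, H x) act
   as a Lie algebra.  The associativity and unit isomorphisms of vector spaces are
   equivariant, and their coherence can be checked on pure tensors. *)
Require Import Defs.
From HB Require Import structures.
From mathcomp Require Import all_boot all_algebra.

Set Implicit Arguments.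
Unset Strict Implicit.
Unset Printing Implicit Defensive.

Import GRing.Theory.
Local Open Scope ring_scope.

(** * The laws of admissible representations, and isomorphisms between them *)

Section AdmissibleRep.
Variables (K : fieldType) (A : ucomAlgType K) (S : leibniz_pair A).

Lemma arep_smul_linear (M : arep S) a : linear (arep_smul M a).
Proof. by case: (arep_axiom M) => -[[]]. Qed.

Lemma arep_smul_linearl (M : arep S) m : linear ((arep_smul M)^~ m).
Proof. by case: (arep_axiom M) => -[[]]. Qed.

Lemma arep_smulM (M : arep S) a b m :
  arep_smul M (amul a b) m = arep_smul M a (arep_smul M b m).
Proof. by case: (arep_axiom M) => -[]. Qed.

Lemma arep_smul1 (M : arep S) m : arep_smul M aone m = m.
Proof. by case: (arep_axiom M) => -[]. Qed.

Lemma arep_smulC (M : arep S) a b m :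
  arep_smul M a (arep_smul M b m) = arep_smul M b (arep_smul M a m).
Proof. by rewrite -!arep_smulM amulC. Qed.

Lemma arep_act_linear (M : arep S) x : linear (arep_act M x).
Proof. by case: (arep_axiom M) => _ [[]]. Qed.

Lemma arep_act_linearl (M : arep S) m : linear ((arep_act M)^~ m).
Proof. by case: (arep_axiom M) => _ [[]]. Qed.

Lemma arep_act_lie (M : arep S) x y m :
  arep_act M (lie x y) m
  = arep_act M x (arep_act M y m) - arep_act M y (arep_act M x m).
Proof. by case: (arep_axiom M) => _ []. Qed.

Lemma arep_act_smul (M : arep S) x a m :
  arep_act M x (arep_smul M a m)
  = arep_smul M a (arep_act M x m) + arep_smul M (anchor x a) m.
Proof. by case: (arep_axiom M). Qed.

Lemma anchor_linear (x : S) : linear (anchor x).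
Proof. by case: (anchor_der x). Qed.

Lemma arep_hom_smul (M M' : arep S) (f : arep_hom M M') a m :
  f (arep_smul M a m) = arep_smul M' a (f m).
Proof. by case: (arep_map_axiom f). Qed.

Lemma arep_hom_act (M M' : arep S) (f : arep_hom M M') x m :
  f (arep_act M x m) = arep_act M' x (f m).
Proof. by case: (arep_map_axiom f). Qed.

(** Equivariance of the inverse comes for free: the injective [f] may be applied to both sides. So a
    linear inverse is all that has to be supplied. *)
Lemma arep_iso (M M' : arep S) (f : arep_hom M M') (g : {linear M' -> M}) :
  cancel f g -> cancel g f -> @is_iso (ARep_category S) M M' f.
Proof.
move=> fK gK.
have g_hom : is_arep_hom (arep_smul M') (arep_act M') (arep_smul M) (arep_act M) g.
  by split=> x m; apply: (can_inj fK); rewrite ?arep_hom_smul ?arep_hom_act !gK.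
by exists (ARepHom g g_hom); split; apply: arep_hom_eq => m /=; rewrite ?fK ?gK.
Qed.
End AdmissibleRep.

(** * The actions of S, A and h ⊗ A on V ⊗ M *)

Section CoefficientAction.
Variables (K : fieldType) (A : ucomAlgType K) (S : leibniz_pair A).
Variable h : lieAlgType K.
Implicit Types (V : rep h) (M : arep S).

Definition tensor_act (V : rep h) (M : arep S) (x : S) : V ⊗ M -> V ⊗ M :=
  tmap idfun (arep_act M x).

(** The second summand of [boxplus], separated from [tensor_act] so that the commutators of the two
    can be computed one by one. *)
Definition coef_rep (V : rep h) (M : arep S) (s : h ⊗ A) (u : V ⊗ M) : V ⊗ M :=
  tlift (fun g a => tmap (rep_act V g) (arep_smul M a) u) s.

Lemma tensor_actE V M x (v : V) (m : M) :
  tensor_act x (v ⊗ m) = v ⊗ arep_act M x m.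
Proof. by rewrite /tensor_act tmap_pure //; exact: arep_act_linear. Qed.

Lemma tensor_act_linear V M x : linear (@tensor_act V M x).
Proof. by apply: tmap_linear => //; exact: arep_act_linear. Qed.

Lemma tensor_act_linearl V M u : linear (fun x => @tensor_act V M x u).
Proof. by move=> k x y; apply: tmap_linr => m; exact: arep_act_linearl. Qed.

Lemma tensor_smul_linear V M a : linear (@tensor_smul K A S h V M a).
Proof. by apply: tmap_linear => //; exact: arep_smul_linear. Qed.

Lemma tensor_smul_linearl V M u : linear (fun a => @tensor_smul K A S h V M a u).
Proof. by move=> k x y; apply: tmap_linr => m; exact: arep_smul_linearl. Qed.

Lemma coef_repE V M g a (v : V) (m : M) :
  coef_rep (g ⊗ a) (v ⊗ m) = rep_act V g v ⊗ arep_smul M a m.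
Proof.
rewrite /coef_rep tlift_pure; last exact: boxplus_bilin.
by rewrite tmap_pure //; [exact: rep_act_linear | exact: arep_smul_linear].
Qed.

Lemma coef_rep_linear V M s : linear (@coef_rep V M s).
Proof.
move=> k x y; apply: tlift_comb => g a; apply: tmap_linear.
- exact: rep_act_linear.
- exact: arep_smul_linear.
Qed.

Lemma coef_rep_linearl V M u : linear (fun s => @coef_rep V M s u).
Proof. by apply: tlift_linear; exact: boxplus_bilin. Qed.

Lemma coef_act_linear x : linear (@coef_act K A S h x).
Proof. by apply: tmap_linear => //; exact: anchor_linear. Qed.

Lemma coef_actE (x : S) g a : coef_act x (g ⊗ a : h ⊗ A) = g ⊗ anchor x a.
Proof. by rewrite /coef_act tmap_pure //; exact: anchor_linear. Qed.

(** On pure tensors the two sides differ only in the order in which two elements of the commutative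
    algebra A act on M. *)
Lemma coef_rep_smul V M s a (u : V ⊗ M) :
  coef_rep s (tensor_smul V M a u) = tensor_smul V M a (coef_rep s u).
Proof.
move: s; apply: tensor_ext => [||g b].
- exact: coef_rep_linearl.
- exact: (lin_comp (@tensor_smul_linear V M a) (@coef_rep_linearl V M u)).
move: u; apply: tensor_ext => [||v m].
- exact: (lin_comp (@coef_rep_linear V M _) (@tensor_smul_linear V M a)).
- exact: (lin_comp (@tensor_smul_linear V M a) (@coef_rep_linear V M _)).
by rewrite tensor_smulE !coef_repE tensor_smulE arep_smulC.
Qed.

Lemma tensor_act_lie V M x y (u : V ⊗ M) :
  tensor_act (lie x y) u
  = tensor_act x (tensor_act y u) - tensor_act y (tensor_act x u).
Proof.
elim/tensor_ind: u => [v m|u u' IHu IHu'].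
  by rewrite !tensor_actE arep_act_lie (linB (@pure_linr _ _ _ _)).
by rewrite !(linD (@tensor_act_linear V M _)) IHu IHu' sub_addACA.
Qed.

Lemma tensor_act_smul V M x a (u : V ⊗ M) :
  tensor_act x (tensor_smul V M a u)
  = tensor_smul V M a (tensor_act x u) + tensor_smul V M (anchor x a) u.
Proof.
elim/tensor_ind: u => [v m|u u' IHu IHu'].
  rewrite tensor_actE !tensor_smulE tensor_actE arep_act_smul.
  by rewrite (linD (@pure_linr _ _ _ _)).
rewrite !(linD (@tensor_act_linear V M _)) !(linD (@tensor_smul_linear V M _)).
by rewrite (linD (@tensor_act_linear V M _)) IHu IHu' addrACA.
Qed.

(** This is the admissibility of M read on pure tensors: for s = g ⊗ a, the extra term [anchor x a]
    of the Leibniz rule is the A-coefficient of [coef_act x s]. *)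
Lemma tensor_act_coef_rep V M x s (u : V ⊗ M) :
  tensor_act x (coef_rep s u)
  = coef_rep s (tensor_act x u) + coef_rep (coef_act x s) u.
Proof.
elim/tensor_ind: s => [g a|s t IHs IHt]; last first.
  rewrite (linD (@coef_act_linear x)) !(linD (@coef_rep_linearl V M _)).
  by rewrite (linD (@tensor_act_linear V M _)) IHs IHt addrACA.
elim/tensor_ind: u => [v m|u u' IHu IHu'].
  rewrite coef_actE tensor_actE !coef_repE tensor_actE arep_act_smul.
  by rewrite (linD (@pure_linr _ _ _ _)).
rewrite !(linD (@coef_rep_linear V M _)) !(linD (@tensor_act_linear V M _)).
by rewrite (linD (@coef_rep_linear V M _)) IHu IHu' addrACA.
Qed.

(** Since A is commutative, both products of the operators of g ⊗ a and g' ⊗ b multiply M by ab,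
    which leaves the commutator of g and g' on V. *)
Lemma coef_rep_lie V M (s t : (h ⊗ A)%type) (u : V ⊗ M) :
  coef_rep (lie s t) u = coef_rep s (coef_rep t u) - coef_rep t (coef_rep s u).
Proof.
elim/tensor_ind: s => [g a|s s' IHs IHs']; last first.
  rewrite (linD (lie_linearl t)) !(linD (@coef_rep_linearl V M _)).
  by rewrite (linD (@coef_rep_linear V M _)) IHs IHs' sub_addACA.
elim/tensor_ind: t => [g' b|t t' IHt IHt']; last first.
  rewrite (linD (lie_linearr (g ⊗ a : (h ⊗ A)%type))).
  rewrite !(linD (@coef_rep_linearl V M _)).
  by rewrite (linD (@coef_rep_linear V M _)) IHt IHt' sub_addACA.
elim/tensor_ind: u => [v m|u u' IHu IHu'].
  rewrite [lie _ _]tlieE !coef_repE rep_actE (linB (@pure_linl _ _ _ _)).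
  by rewrite -!arep_smulM (amulC b).
by rewrite !(linD (@coef_rep_linear V M _)) IHu IHu' sub_addACA.
Qed.

(** * Naturality of the three actions in V and M *)

Lemma tmap_coef_rep V V' M M' (psi : rep_hom V V') (phi : arep_hom M M')
    s (u : V ⊗ M) :
  tmap psi phi (coef_rep s u) = coef_rep s (tmap psi phi u).
Proof.
move: s; apply: tensor_ext => [||g a].
- exact: (lin_comp (linearP (tmap psi phi)) (@coef_rep_linearl V M u)).
- exact: coef_rep_linearl.
move: u; apply: tensor_ext => [||v m].
- exact: (lin_comp (linearP (tmap psi phi)) (@coef_rep_linear V M _)).
- exact: (lin_comp (@coef_rep_linear V' M' _) (linearP (tmap psi phi))).
by rewrite coef_repE !tmapE coef_repE rep_map_equiv arep_hom_smul.
Qed.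

Lemma tmap_tensor_act V V' M M' (psi : rep_hom V V') (phi : arep_hom M M')
    x (u : V ⊗ M) :
  tmap psi phi (tensor_act x u) = tensor_act x (tmap psi phi u).
Proof.
move: u; apply: tensor_ext => [||v m].
- exact: (lin_comp (linearP (tmap psi phi)) (@tensor_act_linear V M _)).
- exact: (lin_comp (@tensor_act_linear V' M' _) (linearP (tmap psi phi))).
by rewrite tensor_actE !tmapE tensor_actE arep_hom_act.
Qed.

Lemma tmap_tensor_smul V V' M M' (psi : rep_hom V V') (phi : arep_hom M M')
    a (u : V ⊗ M) :
  tmap psi phi (tensor_smul V M a u) = tensor_smul V' M' a (tmap psi phi u).
Proof.
move: u; apply: tensor_ext => [||v m].
- exact: (lin_comp (linearP (tmap psi phi)) (@tensor_smul_linear V M _)).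
- exact: (lin_comp (@tensor_smul_linear V' M' _) (linearP (tmap psi phi))).
by rewrite tensor_smulE !tmapE tensor_smulE arep_hom_smul.
Qed.
End CoefficientAction.

(** * The bifunctor induced by a crossed homomorphism *)

Section CrossedHomomorphism.
Variables (K : fieldType) (A : ucomAlgType K) (S : leibniz_pair A).
Variables (h : lieAlgType K) (H : S -> (h ⊗ A)%type).
Hypothesis crossedH : crossed_hom H.

Lemma boxplus_iotaE (V : rep h) (M : arep S) x u :
  (boxplus V M \o iota_graph H) x u = tensor_act x u + coef_rep (H x) u.
Proof. by []. Qed.

Lemma boxplus_iota_lie_rep (V : rep h) (M : arep S) :
  is_lie_rep (boxplus V M \o iota_graph H).
Proof.
case: crossedH => H_lin H_lie; split.
  split=> [u|x]; last exact: boxplus_linear.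
  apply: lin_add; first exact: tensor_act_linearl.
  exact: (lin_comp (@coef_rep_linearl _ _ _ _ V M u) H_lin).
move=> x y u; rewrite !boxplus_iotaE H_lie tensor_act_lie.
rewrite (linD (@coef_rep_linearl _ _ _ _ V M u)).
rewrite (linB (@coef_rep_linearl _ _ _ _ V M u)) coef_rep_lie.
rewrite !(linD (@coef_rep_linear _ _ _ _ V M _)).
rewrite !(linD (@tensor_act_linear _ _ _ _ V M _)) !tensor_act_coef_rep.
rewrite !opprD !addrA.
(* The commutator has ten terms. Pairs 2, 9 and 4, 7 are the mixed composites [coef_rep (H y)] after
   [tensor_act x] and [coef_rep (H x)] after [tensor_act y]; each occurs with both signs and
   cancels. The other six are the image of [lie x y]. *)
rewrite [RHS](ACl (1*6*(3*8)*(5*10)*(2*9)*(4*7)))/= !subrr !addr0.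
by rewrite !addrA.
Qed.

Lemma boxplus_iota_admissible (V : rep h) (M : arep S) :
  is_admissible (tensor_smul V M) (boxplus V M \o iota_graph H).
Proof.
split; last 2 [exact: boxplus_iota_lie_rep].
- split=> [|a b|].
  + split=> [u|a]; [exact: tensor_smul_linearl | exact: tensor_smul_linear].
  + apply: tensor_ext => [||v m]; first exact: tensor_smul_linear.
      exact: (lin_comp (@tensor_smul_linear _ _ _ _ V M a)
                       (@tensor_smul_linear _ _ _ _ V M b)).
    by rewrite !tensor_smulE arep_smulM.
  + apply: tensor_ext => [||v m] //; first exact: tensor_smul_linear.
    by rewrite tensor_smulE arep_smul1.
(* The anchor term comes from [tensor_act] alone, because [coef_rep] commutes with A. *)
- move=> x a u; rewrite !boxplus_iotaE tensor_act_smul coef_rep_smul addrAC.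
  by rewrite (linD (@tensor_smul_linear _ _ _ _ V M a)).
Qed.

Definition crossed_ob (V : rep h) (M : arep S) : arep S :=
  ARep (boxplus_iota_admissible V M).

Lemma crossed_ob_actE (V : rep h) (M : arep S) x u :
  arep_act (crossed_ob V M) x u = tensor_act x u + coef_rep (H x) u.
Proof. by []. Qed.

Lemma tmap_is_arep_hom (V V' : rep h) (M M' : arep S)
    (psi : rep_hom V V') (phi : arep_hom M M') :
  is_arep_hom (tensor_smul V M) (boxplus V M \o iota_graph H)
    (tensor_smul V' M') (boxplus V' M' \o iota_graph H) (tmap psi phi).
Proof.
split=> [a|x] u; first exact: tmap_tensor_smul.
by rewrite !boxplus_iotaE linearD /= tmap_tensor_act tmap_coef_rep.
Qed.

Definition crossed_hom_map (V V' : rep h) (M M' : arep S)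
    (psi : rep_hom V V') (phi : arep_hom M M') :
    arep_hom (crossed_ob V M) (crossed_ob V' M') :=
  @ARepHom K A S (crossed_ob V M) (crossed_ob V' M')
    (tmap psi phi) (tmap_is_arep_hom psi phi).

Definition crossed_bifunctor :
  bifunctor (Rep_monoidal h) (ARep_category S) (ARep_category S).
Proof.
refine (@Bifunctor _ _ _
  (@BifunctorData (Rep_monoidal h) (ARep_category S) (ARep_category S)
     crossed_ob crossed_hom_map) _ _).
- move=> V M; apply: arep_hom_eq; apply: tensor_ext; try exact: linearP.
  by move=> v m; rewrite /= tmapE.
- move=> *; apply: arep_hom_eq; apply: tensor_ext; try exact: linearP.
  by move=> v m; rewrite /= !tmapE.
Defined.

(** * The associativity isomorphism *)

(** An element of h acts on U ⊗ V by the Leibniz rule; after reassociation its two terms are the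
    action inside V ⊗ M and the action on the outer factor U. Here s is arbitrary because [H x] need
    not be pure. *)
Lemma tassoc_coef_rep (U V : rep h) (M : arep S) s u v m :
  tassoc (coef_rep (V := rep_tensor U V) (M := M) s (u ⊗ v ⊗ m))
  = (u : U) ⊗ coef_rep s ((v : V) ⊗ m)
    + coef_rep (M := crossed_ob V M) s (u ⊗ (v ⊗ m)).
Proof.
elim/tensor_ind: s => [g a|s t IHs IHt].
  rewrite !coef_repE /= rep_tensor_actE (linD (@pure_linl _ _ _ _)) linearD /=.
  by rewrite !tassocE addrC tensor_smulE.
rewrite !(linD (@coef_rep_linearl _ _ _ _ _ _ _)) linearD /= IHs IHt.
by rewrite (linD (@pure_linr _ _ _ _)) addrACA.
Qed.

Lemma tassoc_is_arep_hom (U V : rep h) (M : arep S) :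
  is_arep_hom (arep_smul (crossed_ob (rep_tensor U V) M))
    (arep_act (crossed_ob (rep_tensor U V) M))
    (arep_smul (crossed_ob U (crossed_ob V M)))
    (arep_act (crossed_ob U (crossed_ob V M))) (@tassoc K U V M).
Proof.
split=> [a|x]; apply: tensor_ext3.
- apply: (lin_comp (linearP (@tassoc K U V M))).
  exact: (@arep_smul_linear _ _ _ (crossed_ob (rep_tensor U V) M) a).
- apply: (lin_comp _ (linearP (@tassoc K U V M))).
  exact: (@arep_smul_linear _ _ _ (crossed_ob U (crossed_ob V M)) a).
- move=> u v m; rewrite tassocE /= tensor_smulE.
  by rewrite [RHS]tensor_smulE /= tensor_smulE tassocE.
- apply: (lin_comp (linearP (@tassoc K U V M))).
  exact: (@arep_act_linear _ _ _ (crossed_ob (rep_tensor U V) M) x).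
- apply: (lin_comp _ (linearP (@tassoc K U V M))).
  exact: (@arep_act_linear _ _ _ (crossed_ob U (crossed_ob V M)) x).
(* On the right [H x] enters twice: through the action of x on the inner module and through the
   outer [coef_rep]. These match the two terms of [tassoc_coef_rep]. *)
- move=> u v m; rewrite tassocE !crossed_ob_actE linearD /= tassoc_coef_rep.
  rewrite !tensor_actE tassocE crossed_ob_actE tensor_actE.
  by rewrite (linD (@pure_linr _ _ _ _)) addrA.
Qed.

Definition crossed_assoc (U V : rep h) (M : arep S) :
    arep_hom (crossed_ob (rep_tensor U V) M) (crossed_ob U (crossed_ob V M)) :=
  @ARepHom K A S (crossed_ob (rep_tensor U V) M) (crossed_ob U (crossed_ob V M))
    (@tassoc K U V M) (@tassoc_is_arep_hom U V M).

(** * The unit isomorphism *)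

(** Since h acts by zero on the unit object, the contribution of [H x] disappears and x acts on K ⊗
    M through M alone. *)
Lemma coef_rep_trivial (M : arep S) s (u : (K^o ⊗ M)%type) :
  coef_rep (V := rep_trivial h) s u = 0.
Proof.
elim/tensor_ind: s => [g a|s t IHs IHt]; last first.
  by rewrite (linD (@coef_rep_linearl _ _ _ _ (rep_trivial h) M u)) IHs IHt addr0.
elim/tensor_ind: u => [k m|u u' IHu IHu'].
  by rewrite (@coef_repE _ _ _ _ (rep_trivial h)) (lin0 (@pure_linl _ _ _ _)).
by rewrite (linD (@coef_rep_linear _ _ _ _ (rep_trivial h) M _)) IHu IHu' addr0.
Qed.

Lemma tlunit_is_arep_hom (M : arep S) :
  is_arep_hom (arep_smul (crossed_ob (rep_trivial h) M))
    (arep_act (crossed_ob (rep_trivial h) M))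
    (arep_smul M) (arep_act M) (@tlunit K M).
Proof.
split=> [a|x]; apply: tensor_ext.
- apply: (lin_comp (linearP (@tlunit K M))).
  exact: (@arep_smul_linear _ _ _ (crossed_ob (rep_trivial h) M) a).
- apply: (lin_comp _ (linearP (@tlunit K M))).
  exact: (@arep_smul_linear _ _ _ M a).
- move=> k m; rewrite /= (@tensor_smulE _ _ _ _ (rep_trivial h)) !tlunitE.
  by rewrite (linZ (@arep_smul_linear _ _ _ M a)).
- apply: (lin_comp (linearP (@tlunit K M))).
  exact: (@arep_act_linear _ _ _ (crossed_ob (rep_trivial h) M) x).
- apply: (lin_comp _ (linearP (@tlunit K M))).
  exact: (@arep_act_linear _ _ _ M x).
- move=> k m; rewrite crossed_ob_actE coef_rep_trivial addr0.
  rewrite (@tensor_actE _ _ _ _ (rep_trivial h)) !tlunitE.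
  by rewrite (linZ (@arep_act_linear _ _ _ M x)).
Qed.

Definition crossed_unit (M : arep S) : arep_hom (crossed_ob (rep_trivial h) M) M :=
  @ARepHom K A S (crossed_ob (rep_trivial h) M) M (@tlunit K M)
    (@tlunit_is_arep_hom M).

(** * Invertibility, coherence and the module category *)

Lemma crossed_assoc_iso (U V : rep h) (M : arep S) :
  @is_iso (ARep_category S) _ _ (crossed_assoc U V M).
Proof.
apply: (@arep_iso _ _ _ (crossed_ob (rep_tensor U V) M)
  (crossed_ob U (crossed_ob V M)) (crossed_assoc U V M) (@tassoc_inv K U V M)).
- exact: tassocK.
- exact: tassoc_invK.
Qed.

Lemma crossed_unit_iso (M : arep S) :
  @is_iso (ARep_category S) _ _ (crossed_unit M).
Proof.
apply: (@arep_iso _ _ _ (crossed_ob (rep_trivial h) M) M (crossed_unit M)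
  (@tlunit_inv K M)).
- exact: tlunitK.
- exact: tlunit_invK.
Qed.

Definition crossed_left_module :
  left_module_structure (Rep_monoidal h) (ARep_category S).
Proof.
refine (@LeftModuleStructure (Rep_monoidal h) (ARep_category S) crossed_bifunctor
  crossed_assoc crossed_assoc_iso _ crossed_unit crossed_unit_iso _ _ _).
- move=> *; apply: arep_hom_eq; apply: tensor_ext3; try exact: linearP.
  by move=> u v m; do !rewrite /= ?tassocE ?tmapE.
- move=> *; apply: arep_hom_eq; apply: tensor_ext; try exact: linearP.
  by move=> k m; rewrite /= tmapE /= !tlunitE linearZ.
- move=> *; apply: arep_hom_eq; apply: tensor_ext4; try exact: linearP.
  by move=> u v w m; do !rewrite /= ?tassocE ?tmapE.
- move=> *; apply: arep_hom_eq; apply: tensor_ext3; try exact: linearP.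
  move=> u k m; rewrite /= tassocE !tmapE /= tlunitE trunitE.
  (* The scalar k of the middle factor ends on m on one side and on u on the other; both tensors are
     k times u ⊗ m. *)
  by rewrite (linZ (@pure_linl _ _ _ _)) (linZ (@pure_linr _ _ _ _)).
Defined.
End CrossedHomomorphism.

(** The laws [admF] and [homF] are quantified first because the values of the bifunctor on objects
    and morphisms are records containing them; [E] must then have exactly these data. *)
Theorem theorem3p36 (K : closedFieldType) (charK : [pchar K] =i pred0)
    (A : ucomAlgType K) (S : leibniz_pair A) (h : lieAlgType K)
    (H : S -> (h ⊗ A)%type) (crossedH : crossed_hom H) :
  exists
    (admF : forall (V : rep h) (M : arep S),
       is_admissible (tensor_smul V M) (boxplus V M \o iota_graph H))
    (homF : forall (V V' : rep h) (M M' : arep S)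
       (psi : rep_hom V V') (phi : arep_hom M M'),
       is_arep_hom (tensor_smul V M) (boxplus V M \o iota_graph H)
         (tensor_smul V' M') (boxplus V' M' \o iota_graph H) (tmap psi phi))
    (E : left_module_structure (Rep_monoidal h) (ARep_category S)),
    bf_data (lm_act E) =
    @BifunctorData (Rep_monoidal h) (ARep_category S) (ARep_category S)
      (fun V M => ARep (admF V M))
      (fun V V' M M' psi phi =>
         @ARepHom K A S (ARep (admF V M)) (ARep (admF V' M'))
           (tmap psi phi) (homF V V' M M' psi phi)).
Proof.
exists (boxplus_iota_admissible crossedH), (tmap_is_arep_hom H).
(* The module structure and its bifunctor are transparent, so the equation of data holds by
   conversion. *)
by exists (crossed_left_module crossedH).
Qed.
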